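(* Let $0<p\le q\le\infty$. There exist constants $c,C>0$ depending only on $p$ and $q$ such that for all natural numbers $d\ge 2$ and all natural numbers $k\ge d$, $$ c\, 2^{-k/(d-1)}\, d^{1/q-1/p} \;\le\; e_k(\mathbb{S}_p^{d-1},\ell_q^d) \;\le\; C\, 2^{-k/(d-1)}\, d^{1/q-1/p}. $$
   Context: For $x\in\mathbb{R}^d$ put $\|x\|_p=(\sum_{i=1}^d|x_i|^p)^{1/p}$ if $0<p<\infty$ and $\|x\|_\infty=\max_{1\le i\le d}|x_i|$; $\ell_q^d=(\mathbb{R}^d,\|\cdot\|_q)$; the $p$-sphere is $\mathbb{S}_p^{d-1}=\{x\in\mathbb{R}^d:\|x\|_p=1\}$. Convention: $1/\infty=0$. For a subset $K$ of a finite-dimensional (quasi-)Banach space $Y$ with closed unit ball $B_Y$, and $k\in\mathbb{N}$, $k\ge1$, the $k$-th (dyadic) entropy number is $$e_k(K,Y)=\min\Big\{\varepsilon>0: K\subset\bigcup_{j=1}^{2^{k-1}}(x_j+\varepsilon B_Y)\text{ for some }x_1,\dots,x_{2^{k-1}}\in Y\Big\}.$$ *)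

(* Defs.v *)
From mathcomp Require Export all_boot all_order all_algebra.
From mathcomp Require Export all_classical all_reals all_analysis.

Set Implicit Arguments.
Unset Strict Implicit.
Unset Printing Implicit Defensive.

Import Order.TTheory GRing.Theory Num.Theory.

Local Open Scope classical_set_scope.
Local Open Scope ring_scope.

(* Meaningful for 0 < p <= +oo only; the value at -oo is junk. *)
Definition lpnorm (R : realType) (p : \bar R) (d : nat) (x : 'rV[R]_d) : R :=
  match p with
  | r%:E => (\sum_(i < d) `|x 0 i| `^ r) `^ r^-1
  | +oo%E => \big[Num.max/0]_(i < d) `|x 0 i|
  | -oo%E => 0
  end.

Definition lpsphere (R : realType) (p : \bar R) (d : nat) : set 'rV[R]_d :=
  [set x | lpnorm p x = 1].

Definition lpball (R : realType) (p : \bar R) (d : nat) : set 'rV[R]_d :=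
  [set x | lpnorm p x <= 1].

Arguments lpsphere {R} p d.
Arguments lpball {R} p d.

(* The radii eps > 0 such that 2 ^ (k - 1) translates of eps *: B, with
   arbitrary centres in V, cover K; B plays the role of the closed unit ball
   of a quasi-norm on V. *)
Definition covering_radii (R : realType) (V : lmodType R) (k : nat)
    (K B : set V) : set R :=
  [set eps | 0 < eps /\
    exists x : 'I_(2 ^ k.-1) -> V,
      K `<=` \bigcup_(j : 'I_(2 ^ k.-1)) [set x j + eps *: b | b in B]].

(* The k-th dyadic entropy number (k >= 1): the minimum, not the infimum, of
   the admissible radii. If no minimum exists the value is 0, which is not an
   admissible radius; hence a positive value is always an attained minimum. *)
Definition entropy_number (R : realType) (V : lmodType R) (k : nat)
    (K B : set V) : R :=
  xget 0 (covering_radii k K B `&` lbound (covering_radii k K B)).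

(* Main.v *)
Require Import Defs.
From mathcomp Require Import all_boot all_order all_algebra.
From mathcomp Require Import all_classical all_reals all_analysis.
From mathcomp Require Import ring lra.

(** Write [S] for the p-sphere, [D = d^(1/p)] and [Q = d^(1/q)].  A typical
    point [x] of [S] has coordinates of size [1/D], so the rescaled
    coordinates [D * `|x i|] are of order one; and if all coordinates of a
    vector are at most [h] then its q-norm is at most [Q * h].  The claimed rate
    therefore says that, after this rescaling, [S] behaves in the sup norm
    like a (d-1)-dimensional cube of side one: covering it at scale [t] takes
    about [t^-(d-1)] pieces, up to a factor [C^d].  Both bounds are obtained
    by counting lattice points, which replaces volumes throughout.

    The common tool is [card_lattice_near]: for [0 < t <= 1], at most
    [(C/t)^d] points of the lattice of mesh [t] lie near a given [y], where near
    means coordinatewise within [1 + beta i] for some [beta] with [\sum_i beta i `^ s <= d].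
    A rescaled ball of either quasi-norm is such a neighbourhood
    ([lpnorm_moment]), with [s] its exponent, or [s = 1] for the sup norm.

    Lower bound ([covering_radii_ge]).  Take a fine grid of points [u] in
    the cube [1, 2]^d and project it radially to [S].  If [N] balls of radius
    [eta * Q / D] cover [S], then knowing the ball that contains the
    projection of [u], and the norm of [u] up to a relative error [eta]
    (about [1/eta] values), confines [u] to a rescaled ball of size [eta].
    Counting grid points gives [1 <= N * (3/eta) * (C * eta)^d], that is
    [eta^(d-1) >= C^-d / N].  The one power of [eta] paid for the norm is what
    turns [d] into [d - 1].

    Upper bound ([covering_radii_le]).  Round every point of [S] coordinatewise
    to the lattice of mesh [t/D].  The moduli of two points of [S] can never be
    strictly ordered in all coordinates, so on each line in direction
    (1, ..., 1) at most one cell of moduli is met ([sphere_cells_count]);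
    translating the cells that are met along this diagonal by [0, ..., 1/t] steps
    gives distinct lattice points, still in a neighbourhood to which the
    counting lemma applies, so there are at most [t * (C/t)^d] of them.  This
    requires [2^(k-1)] to exceed some [C^(d-1)].  For the remaining [k >= d]
    a single scale suffices, provided that only [2^(d-1)] centres are used: with
    mesh [A/D], [A] large, most coordinates are rounded to zero and a weighted
    count gives at most [sqrt 2 ^ d] centres ([card_sparse_lattice]).

    Finally, the entropy number is an attained minimum
    ([covering_radii_minimum]): configurations of centres may be taken in a
    compact set, and covering is a closed condition on them. *)

Set Implicit Arguments.
Unset Strict Implicit.
Unset Printing Implicit Defensive.

Import Order.TTheory GRing.Theory Num.Theory.
Import numFieldNormedType.Exports.

Local Open Scope ring_scope.

(** * The quasi-norms and their rescaling *)

(** The exponent [s] for which a rescaled unit vector has mean [s]-th moment at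
    most one; for the sup norm any [s] would do. *)
Definition moment_exp (R : realType) (p : \bar R) : R :=
  if p is r%:E then r else 1.

Lemma one_powR (R : realType) (r : R) : 1 `^ r = 1.
Proof. by rewrite powR1. Qed.

Section LpNorm.
Variables (R : realType) (d : nat).
Implicit Types (p : \bar R) (x y : 'rV[R]_d) (a : R).

Lemma moment_exp_gt0 p : (0 < p)%E -> 0 < moment_exp p.
Proof. by case: p => //= r; rewrite lte_fin. Qed.

Lemma fine_inv_fin r : 0 < r -> fine ((r%:E)^-1)%E = r^-1 :> R.
Proof. by move=> r0; rewrite inver gt_eqF. Qed.

Lemma fine_inv_pinfty : fine ((+oo%E : \bar R)^-1)%E = 0.
Proof. by rewrite invey. Qed.

Lemma lpnorm_fin_le (r : R) x a : 0 < r -> 0 <= a ->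
  (lpnorm r%:E x <= a) = (\sum_(i < d) `|x 0 i| `^ r <= a `^ r).
Proof.
move=> r0 a0 /=; set S := \sum_(i < d) _.
have S0 : 0 <= S by apply: sumr_ge0 => i _; exact: powR_ge0.
have -> : (S `^ r^-1 <= a) = (S `^ r^-1 <= (a `^ r) `^ r^-1).
  by rewrite -[in RHS]powRrM divff ?gt_eqF// powRr1.
have mono : {in Num.nneg &, {mono (@powR R) ^~ r^-1 : u v / u <= v}}.
  by apply: le_mono_in; apply: gt0_ltr_powR; rewrite invr_gt0.
by rewrite mono// nnegrE powR_ge0.
Qed.

Lemma le_lpnorm p x y : (0 < p)%E -> (forall i, `|x 0 i| <= `|y 0 i|) ->
  lpnorm p x <= lpnorm p y.
Proof.
case: p => [r||//] /= p0 xy; last exact: le_bigmax2.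
rewrite lte_fin in p0.
apply: ge0_ler_powR; rewrite ?nnegrE ?invr_ge0 ?(ltW p0)//;
  try by apply: sumr_ge0 => i _; exact: powR_ge0.
by apply: ler_sum => i _; apply: ge0_ler_powR; rewrite ?nnegrE ?(ltW p0).
Qed.

(** Strictness in every coordinate is what makes this true for the sup norm
    too. *)
Lemma lt_lpnorm p x y : (0 < d)%N -> (0 < p)%E ->
  (forall i, `|x 0 i| < `|y 0 i|) -> lpnorm p x < lpnorm p y.
Proof.
move=> d0; case: p => [r||//] /= p0 xy; last first.
  apply/bigmax_ltP; split=> [|i _].
    by apply: lt_le_trans (le_bigmax _ _ (Ordinal d0)); exact: le_lt_trans (xy _).
  exact: lt_le_trans (xy i) (le_bigmax _ _ i).
rewrite lte_fin in p0.
apply: gt0_ltr_powR; rewrite ?nnegrE ?invr_gt0 //;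
  try by apply: sumr_ge0 => i _; exact: powR_ge0.
apply: ltr_sum; last by move=> i _; apply: gt0_ltr_powR; rewrite ?nnegrE.
by apply/hasP; exists (Ordinal d0); rewrite ?mem_index_enum.
Qed.

Lemma lpnorm_const p a : (0 < d)%N -> (0 < p)%E -> 0 <= a ->
  lpnorm p (const_mx a : 'rV[R]_d) = d%:R `^ (fine (p^-1)%E) * a.
Proof.
move=> d0; case: p => [r||//] p0 a0; last first.
  rewrite fine_inv_pinfty powRr0 mul1r /=.
  apply/eqP; rewrite eq_le; apply/andP; split.
    by apply/bigmax_leP; split=> // i _; rewrite mxE ger0_norm.
  by apply: le_trans (le_bigmax _ _ (Ordinal d0)); rewrite mxE ger0_norm.
rewrite lte_fin in p0; rewrite fine_inv_fin //=.
under eq_bigr do rewrite mxE ger0_norm //.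
rewrite sumr_const card_ord -[X in X `^ _ = _]mulr_natl powRM ?powR_ge0//.
by rewrite -powRrM divff ?gt_eqF// powRr1.
Qed.

Lemma lpnorm_le_sup p x a : (0 < d)%N -> (0 < p)%E ->
  (forall i, `|x 0 i| <= a) -> lpnorm p x <= d%:R `^ (fine (p^-1)%E) * a.
Proof.
move=> d0 p0 xa; have a0 : 0 <= a := le_trans (normr_ge0 _) (xa (Ordinal d0)).
by rewrite -lpnorm_const //; apply: le_lpnorm => // i; rewrite mxE [leRHS]ger0_norm.
Qed.

Lemma lpnorm_ge_inf p x a : (0 < d)%N -> (0 < p)%E -> 0 <= a ->
  (forall i, a <= `|x 0 i|) -> d%:R `^ (fine (p^-1)%E) * a <= lpnorm p x.
Proof.
move=> d0 p0 a0 xa.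
by rewrite -lpnorm_const //; apply: le_lpnorm => // i; rewrite mxE ger0_norm.
Qed.

Lemma lpnormZ p x a : (0 < p)%E -> 0 <= a -> lpnorm p (a *: x) = a * lpnorm p x.
Proof.
case: p => [r||//] p0 a0 /=; last first.
  under eq_bigr do rewrite mxE normrM ger0_norm //.
  by elim/big_rec2: _ => [|i u v _ ->]; rewrite ?mulr0// maxr_pMr.
rewrite lte_fin in p0.
under eq_bigr do rewrite mxE normrM ger0_norm // powRM//.
rewrite -mulr_sumr powRM ?powR_ge0//; last by apply: sumr_ge0 => i _; exact: powR_ge0.
by rewrite -powRrM divff ?gt_eqF// powRr1.
Qed.

(** The only information on the unit ball that the counting arguments use. *)
Lemma lpnorm_moment p x : (0 < p)%E -> lpnorm p x <= 1 ->
  \sum_(i < d) (d%:R `^ (fine (p^-1)%E) * `|x 0 i|) `^ (moment_exp p) <= d%:R.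
Proof.
case: p => [r||//] p0.
  rewrite lte_fin in p0; rewrite fine_inv_fin //= => x1.
  under eq_bigr do rewrite powRM ?powR_ge0// -powRrM mulVf ?gt_eqF// powRr1//.
  rewrite -mulr_sumr -[leRHS]mulr1; apply: ler_wpM2l => //.
  by rewrite -[leRHS](one_powR r) -lpnorm_fin_le.
rewrite fine_inv_pinfty /= => /bigmax_leP[_ x1].
rewrite -[d in leRHS]card_ord -sum1_card natr_sum; apply: ler_sum => i _.
by rewrite powRr0 mul1r powRr1// x1.
Qed.

Lemma lpnorm_coord p x i : (0 < p)%E -> `|x 0 i| <= lpnorm p x.
Proof.
case: p => [r||//] p0 /=; last exact: le_bigmax.
rewrite lte_fin in p0.
rewrite -[leLHS]powRr1// -[X in _ `^ X](@divff _ r) ?gt_eqF// powRrM.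
apply: ge0_ler_powR; rewrite ?nnegrE ?powR_ge0 ?invr_ge0 ?(ltW p0)//.
  by apply: sumr_ge0 => j _; exact: powR_ge0.
by rewrite (bigD1 i)//= lerDl; apply: sumr_ge0 => j _; exact: powR_ge0.
Qed.

End LpNorm.

(** For [r <= 1] the function is not differentiable at zero, where continuity has
    to be checked by hand. *)
Lemma continuous_norm_powR (R : realType) (r : R) : 0 < r ->
  continuous (fun t : R => `|t| `^ r).
Proof.
move=> r0 t; have [->|t0] := eqVneq t 0.
  rewrite /continuous_at normr0 powR0 ?gt_eqF//.
  apply/cvgrPdist_lt => e e0; near=> s.
  rewrite sub0r normrN ger0_norm ?powR_ge0//.
  have -> : e = (e `^ r^-1) `^ r by rewrite -powRrM mulVf ?gt_eqF// powRr1// ltW.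
  apply: gt0_ltr_powR; rewrite ?nnegrE ?powR_ge0//.
  near: s; have := @nbhsx_ballx R R 0 (e `^ r^-1) (powR_gt0 _ e0).
  apply: filterS => s; by rewrite /ball/= sub0r normrN.
apply: (@continuous_comp _ _ _ (fun t : R => `|t|) (fun t => t `^ r)).
  exact: norm_continuous.
apply: differentiable_continuous; apply/derivable1_diffP.
by apply: derivable_powR; rewrite in_itv/= andbT normr_gt0.
Unshelve. all: by end_near. Qed.

Lemma closed_lpnorm_le (R : realType) (p : \bar R) d (e : R) (x : 'rV[R]_d) :
  (0 < p)%E -> 0 <= e -> closed [set y | lpnorm p (x - y) <= e]%classic.
Proof.
move=> p0 e0.
have clle (f : 'rV[R]_d -> R) a : continuous f -> closed [set y | f y <= a]%classic.
  move=> cf; apply: (@closed_comp _ _ f [set t | t <= a]%classic).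
    by move=> y _; exact: cf.
  exact: closed_le.
have ccoord i : continuous (fun y : 'rV[R]_d => (x - y) 0 i).
  rewrite (_ : (fun y => _) = (fun y : 'rV[R]_d => x 0 i - y 0 i)); last first.
    by apply/funext => y; rewrite !mxE.
  move=> y; apply: (@continuous_comp _ _ _ (fun y : 'rV[R]_d => y 0 i) (fun t => x 0 i - t)).
    exact: coord_continuous.
  by apply: cvgB; [exact: cvg_cst|exact: cvg_id].
case: p p0 => [r||//] p0; last first.
  rewrite (_ : mkset _ =
      \bigcap_(i in [set: 'I_d]) [set y : 'rV[R]_d | `|(x - y) 0 i| <= e])%classic.
    apply: closed_bigI => i _; apply: clle => y.
    by apply: continuous_comp; [exact: ccoord|exact: norm_continuous].
  apply/seteqP; split=> y /=; first by move=> /bigmax_leP[_ h] i _; exact: h.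
  by move=> h; apply/bigmax_leP; split=> // i _; exact: h.
rewrite lte_fin in p0.
under eq_set do rewrite lpnorm_fin_le//.
apply: clle; apply: continuous_big; first exact: add_continuous.
move=> i _ y.
apply: (@continuous_comp _ _ _ (fun y : 'rV[R]_d => (x - y) 0 i) (fun t => `|t| `^ r)).
  exact: ccoord.
exact: continuous_norm_powR.
Qed.

(** * Counting lattice points *)

(** Union bound with product weights: a sum over all functions of a product of
    weights factorises, so it is at most [A ^+ d], while each member of [Z]
    contributes at least [L^-1]. *)
Lemma card_le_weight (R : realType) d (T : finType) (w : 'I_d -> T -> R)
    (A L : R) (Z : {set {ffun 'I_d -> T}}) :
  0 <= L -> (forall i a, 0 <= w i a) -> (forall i, \sum_a w i a <= A) ->
  (forall z, z \in Z -> 1 <= L * \prod_i w i (z i)) ->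
  #|Z|%:R <= L * A ^+ d.
Proof.
move=> L0 w0 wA wZ; rewrite -sum1_card natr_sum.
have wp0 (z : {ffun 'I_d -> T}) : 0 <= \prod_i w i (z i).
  by apply: prodr_ge0 => i _; exact: w0.
apply: (@le_trans _ _ (\sum_(z : {ffun 'I_d -> T}) L * \prod_i w i (z i))).
  rewrite big_mkcond/=; apply: ler_sum => z _.
  by case: ifPn => [/wZ//|_]; rewrite mulr_ge0.
rewrite -mulr_sumr ler_wpM2l// -(bigA_distr_bigA w).
rewrite -[X in A ^+ X](card_ord d) -prodr_const.
by apply: ler_prod => i _; rewrite wA andbT sumr_ge0.
Qed.

Section Counting.
Variable R : realType.
Implicit Types (s t : R).

(** A bounded increasing function whose increments decay quadratically.  Its
    increments along an arithmetic progression serve as weights: they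
    telescope, so their sum is bounded whatever the real offset. *)
Definition squash (x : R) : R := x / (1 + `|x|).

Lemma squash_bound x : `|squash x| <= 1.
Proof.
rewrite /squash normrM normfV (ger0_norm (addr_ge0 _ _))//.
have x0 := normr_ge0 x.
by rewrite ler_pdivrMr; lra.
Qed.

Lemma squash_incr x t : 0 < t <= 1 ->
  t <= (squash (x + t) - squash x) * (2 * (1 + `|x|) ^+ 2).
Proof.
move=> /andP[t0 t1]; rewrite /squash.
have [x0|x0] := leP 0 x.
  rewrite !ger0_norm//; last by lra.
  have -> : ((x + t) / (1 + (x + t)) - x / (1 + x)) * (2 * (1 + x) ^+ 2)
      = t * (2 * (1 + x) / (1 + (x + t))) by field; apply/andP; split; apply/eqP; lra.
  rewrite ler_peMr; [by []|lra|].
  by rewrite ler_pdivlMr; lra.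
rewrite (ltr0_norm x0).
have [xt0|xt0] := leP (x + t) 0.
  rewrite ler0_norm//.
  have -> : ((x + t) / (1 - (x + t)) - x / (1 - x)) * (2 * (1 - x) ^+ 2)
      = t * (2 * (1 - x) / (1 - (x + t))) by field; apply/andP; split; apply/eqP; lra.
  rewrite ler_peMr; [by []|lra|].
  by rewrite ler_pdivlMr; lra.
rewrite gtr0_norm//.
have h1 : (x + t) / 2 <= (x + t) / (1 + (x + t)).
  by rewrite ler_wpM2l ?lef_pV2 ?posrE; lra.
have h2 : (- x) / 2 <= - (x / (1 - x)).
  by rewrite -mulNr ler_wpM2l ?lef_pV2 ?posrE; lra.
have h3 : t / 2 <= (x + t) / (1 + (x + t)) - x / (1 - x) by lra.
have h4 : 2 <= 2 * (1 - x) ^+ 2 by nra.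
apply: (@le_trans _ _ (t / 2 * 2)); first by lra.
by apply: ler_pM => //; lra.
Qed.

(** The inequality [u <= expR u] for [u = x `^ s], raised to the power [1/s]. *)
Lemma le_expR_powR s x : 0 < s -> 0 <= x -> x <= expR (s^-1 * x `^ s).
Proof.
move=> s0 x0; rewrite mulrC expRM.
rewrite -[leLHS](powRr1 x0) -[X in _ `^ X](@divff _ s) ?gt_eqF// powRrM.
apply: ge0_ler_powR; rewrite ?nnegrE ?invr_ge0 ?(ltW s0) ?powR_ge0 ?expR_ge0//.
by apply: le_trans (expR_ge1Dx _); lra.
Qed.

(** Turns a product of quadratic factors into the exponential of a sum of
    [s]-th powers, which a moment bound controls. *)
Lemma sqr_le_expR s x : 0 < s -> 0 <= x ->
  (1 + x) ^+ 2 <= 4 * expR (2 / s * x `^ s).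
Proof.
move=> s0 x0.
have h : 1 + x <= 2 * expR (s^-1 * x `^ s).
  have h1 := le_expR_powR s0 x0.
  have h2 : 1 <= expR (s^-1 * x `^ s).
    rewrite -expR0 ler_expR mulr_ge0 ?powR_ge0 ?invr_ge0//; exact: ltW.
  lra.
have -> : 4 * expR (2 / s * x `^ s) = (2 * expR (s^-1 * x `^ s)) ^+ 2.
  rewrite exprMn; congr (_ * _); first by rewrite expr2; lra.
  by rewrite expr2 -expRD; congr expR; lra.
rewrite lerXn2r ?nnegrE//; first by lra.
Qed.

(** Weigh the integer [m] at coordinate [i] by the increment of [squash] from
    [t * m - y i] to [t * (m + 1) - y i].  The weights sum to at most 2, and each
    is at least [t / (2 * (1 + `|t * m - y i|) ^+ 2)]; the moment bound on [beta]
    makes the product of these lower bounds at least [(c * t) ^+ d]. *)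
Lemma card_lattice_near (s t : R) d n (y : 'I_d -> R)
    (Z : {set {ffun 'I_d -> 'I_n}}) : 0 < s -> 0 < t <= 1 ->
  (forall z, z \in Z -> exists beta : 'I_d -> R,
    [/\ forall i, 0 <= beta i, \sum_i beta i `^ s <= d%:R &
        forall i, `|t * (z i)%:R - y i| <= 1 + beta i]) ->
  #|Z|%:R <= (64 * expR (2 / s) / t) ^+ d.
Proof.
move=> s0 /andP[t0 t1] Zy.
pose w (i : 'I_d) (m : 'I_n) : R :=
  squash (t * m.+1%:R - y i) - squash (t * m%:R - y i).
have wE i m : t <= w i m * (2 * (1 + `|t * m%:R - y i|) ^+ 2).
  have := @squash_incr (t * m%:R - y i) t.
  rewrite t0 t1 => /(_ isT); congr (_ <= (squash _ - _) * _).
  by rewrite -natr1; lra.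
have -> : (64 * expR (2 / s) / t) ^+ d
    = (32 * expR (2 / s) / t) ^+ d * 2 ^+ d.
  by rewrite -exprMn; congr (_ ^+ _); lra.
have e0 : 0 < 32 * expR (2 / s) / t by rewrite divr_gt0// mulr_gt0// expR_gt0.
have pos (x : R) : 0 < 2 * (1 + `|x|) ^+ 2.
  by have := normr_ge0 x; rewrite mulr_gt0 ?exprn_gt0//; lra.
apply: (@card_le_weight _ _ _ w); first by rewrite exprn_ge0// ltW.
- move=> i a; have := le_trans (ltW t0) (wE i a); rewrite pmulr_lge0//.
- move=> i; rewrite -(big_mkord xpredT
    (fun m => squash (t * m.+1%:R - y i) - squash (t * m%:R - y i))).
  rewrite telescope_sumr//.
  have := squash_bound (t * n%:R - y i); have := squash_bound (t * 0%:R - y i).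
  by rewrite !ler_norml => /andP[? ?] /andP[? ?]; lra.
move=> z /Zy [beta [b0 bs bz]].
rewrite -[X in _ ^+ X](card_ord d) -prodr_const -big_split/=.
apply: (@le_trans _ _ (\prod_(i < d) expR (2 / s - 2 / s * beta i `^ s))).
  rewrite -expR_sum -[leLHS]expR0 ler_expR.
  rewrite big_split/= sumrN sumr_const card_ord -[X in _ <= X - _]mulr_natr -mulr_sumr.
  have : 0 <= 2 / s by rewrite divr_ge0// ltW.
  nra.
apply: ler_prod => i _; rewrite expR_ge0/=.
have wi := wE i (z i).
have h1 : (1 + `|t * (z i)%:R - y i|) ^+ 2 <= 16 * expR (2 / s * beta i `^ s).
  have bi := bz i; have b0i := b0 i.
  apply: (@le_trans _ _ ((2 * (1 + beta i)) ^+ 2)).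
    by rewrite lerXn2r ?nnegrE ?addr_ge0 ?mulr_ge0 ?addr_ge0//; lra.
  rewrite exprMn; have := sqr_le_expR s0 (b0 i).
  set u := (1 + beta i) ^+ 2; set e := expR _; clearbody u e; lra.
have w0 : 0 <= w i (z i) by have := le_trans (ltW t0) wi; rewrite pmulr_lge0.
rewrite expRD expRN.
rewrite ler_pdivrMr ?expR_gt0//.
set eb := expR (_ * _ `^ _) in h1 *; set e2 := expR _.
have -> : 32 * e2 / t * w i (z i) * eb = e2 * (32 * (w i (z i) * eb) / t).
  by field; rewrite gt_eqF.
rewrite ler_peMr ?expR_ge0// ler_pdivlMr// mul1r.
apply: le_trans wi _; have := ler_wpM2l w0 h1; lra.
Qed.

Lemma sum_inv_consecutive n :
  \sum_(m < n) (if (m : nat) == 0%N then 0 else (m%:R * (m.+1)%:R)^-1) <= 1 :> R.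
Proof.
rewrite -(big_mkord xpredT (fun m => if m == 0%N then 0 else (m%:R * (m.+1)%:R)^-1)).
case: n => [|n]; first by rewrite big_geq.
rewrite big_nat_recl//= add0r.
rewrite (eq_bigr (fun i => - (i.+2%:R)^-1 - (- (i.+1%:R)^-1))).
  rewrite (telescope_sumr (fun i => - (i.+1%:R)^-1))//.
  by rewrite opprK invr1 gerDr oppr_le0 invr_ge0.
move=> i _; rewrite -[i.+2%:R]natr1.
have h : 0 < i.+1%:R :> R by [].
by field; apply/andP; split; apply/eqP; lra.
Qed.

(** Signed lattice points of small [s]-th moment.  The value zero has weight 1
    and each sign of [m >= 1] has weight [1 / (10 * m * (m + 1))], so the weights
    of one coordinate sum to at most 6/5.  The constant [8 * (19 + 2 / s)] is
    such that the product of the weights is at least [expR (- d / 8)], and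
    [expR (1/8) * 6/5 < sqrt 2].  Sharpness of the base matters:
    [sqrt 2 ^ d <= 2 ^ (d - 1)] as soon as [d >= 2]. *)
Lemma card_sparse_lattice (s : R) d n (Z : {set {ffun 'I_d -> bool * 'I_n}}) :
  0 < s -> (2 <= d)%N ->
  (forall z, z \in Z ->
    (forall i, ((z i).2 : nat) = 0%N -> (z i).1 = false) /\
    \sum_i (8 * (19 + 2 / s)) * (z i).2%:R `^ s <= d%:R) ->
  (#|Z| <= 2 ^ d.-1)%N.
Proof.
move=> s0 d2 Zs; set K := 19 + 2 / s in Zs.
have K0 : 0 < K by rewrite addr_gt0// divr_gt0.
pose w (i : 'I_d) (c : bool * 'I_n) : R :=
  if (c.2 : nat) == 0%N then (~~ c.1)%:R else (10 * (c.2%:R * (c.2).+1%:R))^-1.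
have cZ : #|Z|%:R <= expR (8^-1) ^+ d * (6 / 5) ^+ d :> R.
  apply: (@card_le_weight _ _ _ w); first by rewrite exprn_ge0// expR_ge0.
  - by move=> i c; rewrite /w; case: ifP => // _; rewrite invr_ge0.
  - move=> i; rewrite -(pair_bigA _ (fun b m => w i (b, m)))/= big_bool /w/=.
    have h1 : \sum_(m < n) (if (m : nat) == 0%N then 0
        else (10 * (m%:R * (m.+1)%:R))^-1) <= 10^-1 :> R.
      rewrite -[leRHS]mulr1; apply: le_trans (ler_wpM2l _ (sum_inv_consecutive n)) => //.
      by rewrite mulr_sumr; apply: ler_sum => m _; case: ifP => _; rewrite ?mulr0// invfM.
    have h2 : \sum_(m < n) (if (m : nat) == 0%N then 1
        else (10 * (m%:R * (m.+1)%:R))^-1) <= 1 + 10^-1 :> R.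
      case: n h1 {Z Zs w} => [|n]; first by rewrite !big_ord0; lra.
      by rewrite !big_ord_recl/= add0r; lra.
    by apply: le_trans (lerD h1 h2) _; lra.
  move=> z /Zs [zs zsum].
  rewrite -[X in _ ^+ X](card_ord d) -prodr_const -big_split/=.
  apply: (@le_trans _ _ (\prod_(i < d) expR (8^-1 - K * (z i).2%:R `^ s))).
    rewrite -expR_sum -[leLHS]expR0 ler_expR.
    rewrite big_split/= sumrN sumr_const card_ord -[X in _ <= X - _]mulr_natr -mulr_sumr.
    move: zsum; rewrite -mulr_sumr; lra.
  apply: ler_prod => i _; rewrite expR_ge0/= expRD expRN.
  apply: ler_wpM2l; first exact: expR_ge0.
  rewrite /w; case: ifPn => [/eqP z0|z0].
    by rewrite zs// z0 powR0 ?gt_eqF// mulr0 expR0 invr1.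
  rewrite lef_pV2 ?posrE ?expR_gt0 ?mulr_gt0 ?ltr0n ?lt0n//.
  set m := ((z i).2 : nat) in z0 *.
  have m1 : 1 <= m%:R :> R by rewrite ler1n lt0n.
  have ms1 : 1 <= m%:R `^ s.
    by rewrite -[leLHS](one_powR s); apply: ge0_ler_powR; rewrite ?nnegrE// ltW.
  (* The factor 20 is absorbed by [expR (19 * m%:R `^ s)], as [m >= 1]. *)
  apply: (@le_trans _ _ (20 * expR (2 / s * m%:R `^ s))).
    have := @le_expR_powR s m%:R s0 (ler0n _ _).
    have -> : expR (2 / s * m%:R `^ s) = expR (s^-1 * m%:R `^ s) ^+ 2.
      by rewrite expr2 -expRD; congr expR; lra.
    by rewrite -natr1; nra.
  have -> : K * m%:R `^ s = 19 * m%:R `^ s + 2 / s * m%:R `^ s by rewrite /K mulrDl.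
  rewrite expRD ler_wpM2r ?expR_ge0//.
  by apply: le_trans (expR_ge1Dx _); lra.
have e8 : expR (8^-1) <= 8 / 7 :> R.
  rewrite -[leLHS]invrK -expRN -[leRHS]invrK lef_pV2 ?posrE ?invr_gt0 ?expR_gt0//.
  by apply: le_trans (expR_ge1Dx _); rewrite invf_div; lra.
have : (#|Z|%:R : R) ^+ 2 <= 2 ^+ d.
  apply: (@le_trans _ _ ((expR (8^-1) ^+ d * (6 / 5) ^+ d) ^+ 2)).
    by rewrite lerXn2r ?nnegrE// mulr_ge0 ?exprn_ge0 ?expR_ge0//; lra.
  rewrite -exprMn exprAC lerXn2r ?nnegrE ?exprn_ge0 ?mulr_ge0 ?expR_ge0//.
  have := expR_ge0 (8^-1 : R); nra.
rewrite -!natrX ler_nat => h.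
rewrite -(leq_exp2r _ _ (isT : 0 < 2)%N) -expnM; apply: leq_trans h _.
rewrite leq_exp2l//; case: d d2 {Z Zs w cZ} => [|[|d]]// _.
by rewrite muln2 -addnn /= addSn addnS ltnS ltnS leq_addr.
Qed.

End Counting.

(** * The lower bound *)

Lemma card_le_fibers (R : realType) (T L : finType) (f : T -> L) (B : R) :
  (forall l, #|[set z | f z == l]|%:R <= B) -> #|T|%:R <= #|L|%:R * B.
Proof.
move=> fB; rewrite -sum1_card (partition_big f xpredT)//= natr_sum.
rewrite mulr_natl -sumr_const; apply: ler_sum => l _.
by rewrite sum1dep_card; apply: fB.
Qed.

Lemma powR_neg_rootX (R : realType) (a : R) k e : 0 < a -> (0 < e)%N ->
  (a `^ (- (k%:R / e%:R))) ^+ e = a ^- k.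
Proof.
move=> a0 e0; rewrite -powR_mulrn ?powR_ge0// -powRrM mulNr.
by rewrite divfK ?pnatr_eq0 -?lt0n// powR_invn// ltW.
Qed.

Section LowerBound.
Variable R : realType.

(** The point [u = 1 + z / n] of the cube, of norm [sg], has projection
    [u / sg] in some ball [x j + eps * b].  With [s] the value of the norm grid
    just below [sg], one has
    [u - s * x j = (sg - s) * (u / sg) + s * eps * b]; in every coordinate the
    first term is at most [2 * eta] and the second at most [2 * eta] times the
    modulus of a rescaled vector of the unit ball.  This exact identity stands
    in for the quasi-triangle inequality. *)
Lemma cube_point_near (p q : \bar R) (d n M N : nat) (eps eta : R)
    (x : 'I_N -> 'rV[R]_d) (z : {ffun 'I_d -> 'I_n}) :
  (0 < p)%E -> (0 < q)%E -> (0 < d)%N -> 0 < eta ->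
  eps = eta * d%:R `^ (fine (q^-1)%E - fine (p^-1)%E) ->
  eta^-1 <= M%:R ->
  (lpsphere p d `<=`
    \bigcup_(j : 'I_N) [set x j + eps *: b | b in lpball q d])%classic ->
  exists (l : 'I_N * 'I_M.+1) (beta : 'I_d -> R),
    [/\ forall i, 0 <= beta i,
        \sum_i beta i `^ (moment_exp q) <= d%:R &
        forall i, `|(2 * eta * n%:R)^-1 * (z i)%:R
          - (d%:R `^ (fine (p^-1)%E) * (1 + l.2%:R / M%:R) * x l.1 0 i - 1)
              / (2 * eta)| <= 1 + beta i].
Proof.
move=> p0 q0 d0 eta0 epsE etaM cov.
set D := d%:R `^ (fine (p^-1)%E); set Q := d%:R `^ (fine (q^-1)%E).
have D0 : 0 < D by rewrite powR_gt0 ?ltr0n.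
have Q0 : 0 < Q by rewrite powR_gt0 ?ltr0n.
have n0 : (0 < n)%N by apply: leq_ltn_trans (ltn_ord (z (Ordinal d0))).
have nR : 0 < n%:R :> R by rewrite ltr0n.
have M0 : 0 < M%:R :> R by apply: lt_le_trans etaM; rewrite invr_gt0.
have epsD : eps * D = eta * Q.
  rewrite epsE -mulrA -powRD ?subrK// pnatr_eq0 -lt0n d0 implybT//.
pose u : 'rV[R]_d := \row_i (1 + (z i)%:R / n%:R).
have u1 i : 1 <= u 0 i by rewrite mxE lerDl divr_ge0.
have u2 i : u 0 i <= 2.
  by rewrite mxE -lerBrDl ler_pdivrMr// (_ : 2 - 1 = 1 :> R) ?mul1r ?ler_nat 1?ltnW//; lra.
have uabs i : `|u 0 i| = u 0 i by rewrite ger0_norm// (le_trans _ (u1 i)).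
pose sg := lpnorm p u.
have sg1 : D <= sg.
  by rewrite -[D]mulr1; apply: lpnorm_ge_inf => // i; rewrite uabs.
have sg2 : sg <= D * 2.
  by apply: lpnorm_le_sup => // i; rewrite uabs.
have sg0 : 0 < sg by apply: lt_le_trans sg1.
have [j _ [b b1 xb]] : (\bigcup_(j : 'I_N)
    [set x j + eps *: b | b in lpball q d])%classic (sg^-1 *: u).
  by apply: cov; rewrite /lpsphere/= lpnormZ ?invr_ge0 ?(ltW sg0)// mulVf// gt_eqF.
pose a := (sg / D - 1) * M%:R.
have sD1 : 1 <= sg / D by rewrite ler_pdivlMr// mul1r.
have sD2 : sg / D <= 2 by rewrite ler_pdivrMr// mulrC.
have a0 : 0 <= a by rewrite mulr_ge0// ?subr_ge0// ltW.
have aM : a <= M%:R by rewrite /a ler_piMl ?(ltW M0)//; lra.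
have mM : (Num.truncn a < M.+1)%N.
  by rewrite truncn_lt_nat//; apply: le_lt_trans aM _; rewrite ltr_nat.
pose m := Ordinal mM.
have /andP[ma am] : m%:R <= a < m%:R + 1 by rewrite natr1; exact: truncn_itv.
exists (j, m), (fun i => Q * `|b 0 i|); split=> [i||i] /=.
- by rewrite mulr_ge0// ltW.
- exact: lpnorm_moment.
set s := D * (1 + m%:R / M%:R).
have sle : s <= D * 2.
  rewrite ler_pM2l//; suff : m%:R / M%:R <= 1 :> R by lra.
  by rewrite ler_pdivrMr// mul1r (le_trans ma).
have s0 : 0 <= s by rewrite mulr_ge0 ?(ltW D0)// addr_ge0// divr_ge0.
have sdiff : `|sg - s| <= D * eta.
  have -> : sg - s = D * ((a - m%:R) / M%:R).
    by rewrite /s /a; field; rewrite !gt_eqF.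
  rewrite normrM (gtr0_norm D0) ler_pM2l// normrM normfV (gtr0_norm M0).
  rewrite ler_pdivrMr//; apply: (@le_trans _ _ 1); first by rewrite ler_norml; lra.
  by rewrite -(@ler_pM2l _ (eta^-1)) ?invr_gt0// mulKf ?gt_eqF// mulr1.
clearbody s.
have xE : x j 0 i = u 0 i / sg - eps * b 0 i.
  by move/rowP : xb => /(_ i); rewrite !mxE => xb; rewrite [X in X - _]mulrC -xb addrK.
have -> : (2 * eta * n%:R)^-1 * (z i)%:R - (s * x j 0 i - 1) / (2 * eta)
    = (u 0 i * ((sg - s) / sg) + s * eps * b 0 i) / (2 * eta).
  rewrite xE mxE; field; rewrite !gt_eqF//.
rewrite normrM normfV (gtr0_norm (mulr_gt0 _ eta0))// ler_pdivrMr ?mulr_gt0//.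
have h1 : `|u 0 i * ((sg - s) / sg)| <= 2 * eta.
  rewrite normrM uabs; apply: ler_pM => //; first by rewrite (le_trans _ (u1 i)).
  rewrite normrM normfV (gtr0_norm sg0) ler_pdivrMr//.
  apply: le_trans sdiff _; rewrite mulrC ler_pM2l//.
have h2 : `|s * eps * b 0 i| <= 2 * eta * (Q * `|b 0 i|).
  have eps0 : 0 < eps by rewrite epsE mulr_gt0// powR_gt0 ?ltr0n.
  rewrite !normrM (ger0_norm s0) (gtr0_norm eps0) mulrA ler_wpM2r//.
  have : s * eps <= D * 2 * eps by rewrite ler_wpM2r// ltW.
  nra.
by apply: le_trans (ler_normD _ _) _; nra.
Qed.

(** The number [n] of grid points per side cancels: it only has to be large
    enough for the mesh [(2 * eta * n)^-1] of the rescaled grid to be at most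
    one. *)
Lemma covering_count (p q : \bar R) : (0 < p)%E -> (0 < q)%E ->
  forall d k (eps eta : R), (0 < d)%N -> 0 < eta < 1 ->
  eps = eta * d%:R `^ (fine (q^-1)%E - fine (p^-1)%E) ->
  covering_radii k (lpsphere p d) (lpball q d) eps ->
  1 <= 2 ^+ k.-1 * (3 / eta) * (2 * (64 * expR (2 / moment_exp q)) * eta) ^+ d.
Proof.
move=> p0 q0 d k eps eta d0 /andP[eta0 eta1] epsE [_ [x cov]].
set C := 64 * expR _.
have ei0 : 0 <= eta^-1 by rewrite invr_ge0 ltW.
pose M := (Num.truncn eta^-1).+1.
have /andP[M1 M2] : (M%:R - 1 <= eta^-1 <= M%:R).
  by have /andP[h1 h2] := truncn_itv ei0; rewrite -natr1 addrK h1/= natr1 ltW.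
have e20 : 0 <= (2 * eta)^-1 by rewrite invr_ge0 mulr_ge0// ltW.
pose n := (Num.truncn (2 * eta)^-1).+1.
have n2 : (2 * eta)^-1 <= n%:R by have /andP[h1 h2] := truncn_itv e20; rewrite ltW.
have n0 : 0 < n%:R :> R by rewrite ltr0n.
have t0 : 0 < 2 * eta * n%:R by rewrite !mulr_gt0.
have t1 : 1 <= 2 * eta * n%:R.
  rewrite -(@ler_pM2l _ (2 * eta)^-1) ?invr_gt0 ?mulr_gt0// mulr1.
  by rewrite mulKf// mulf_neq0// gt_eqF.
have /choice[f fP] := fun z : {ffun 'I_d -> 'I_n} =>
  cube_point_near z p0 q0 d0 eta0 epsE M2 cov.
have := @card_le_fibers R _ _ f ((C / (2 * eta * n%:R)^-1) ^+ d).
have /[swap]/[apply] : forall l, #|[set z | f z == l]|%:R <= (C / (2 * eta * n%:R)^-1) ^+ d.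
  move=> l; apply: (@card_lattice_near _ _ _ _ _ (fun i =>
    (d%:R `^ (fine (p^-1)%E) * (1 + l.2%:R / M%:R) * x l.1 0 i - 1)
      / (2 * eta))); first exact: moment_exp_gt0.
    by rewrite invr_gt0 t0 invf_le1.
  by move=> z; rewrite inE => /eqP <-; exact: fP.
rewrite card_ffun card_prod !card_ord natrX natrM natrX invrK => h.
have {}h : 1 * n%:R ^+ d <= 2 ^+ k.-1 * M.+1%:R * (2 * C * eta) ^+ d * n%:R ^+ d.
  rewrite mul1r -[leRHS]mulrA -exprMn.
  by rewrite (_ : 2 * C * eta * n%:R = C * (2 * eta * n%:R))//; ring.
rewrite ler_pM2r ?exprn_gt0// in h.
apply: le_trans h _; rewrite ler_wpM2r ?exprn_ge0 ?mulr_ge0 ?expR_ge0 ?(ltW eta0)//.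
rewrite ler_wpM2l ?exprn_ge0//.
have h : eta^-1 >= 1 by rewrite invf_ge1// ltW.
by rewrite -natr1; lra.
Qed.

Lemma covering_radii_ge (p q : \bar R) : (0 < p)%E -> (0 < q)%E ->
  exists2 c : R, 0 < c & forall d k (eps : R), (2 <= d)%N -> (0 < k)%N ->
  covering_radii k (lpsphere p d) (lpball q d) eps ->
  c * 2 `^ (- (k%:R / (d%:R - 1))) * d%:R `^ (fine (q^-1)%E - fine (p^-1)%E)
    <= eps.
Proof.
move=> p0 q0; set C := 64 * expR (2 / moment_exp q).
have C1 : 1 <= C.
  have := expR_ge1Dx (2 / moment_exp q).
  have : 0 < 2 / moment_exp q by rewrite divr_gt0// moment_exp_gt0.
  rewrite /C; lra.
have C0 : 0 < C by apply: lt_le_trans C1.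
have C20 : 0 < 12 * C ^+ 2 by rewrite mulr_gt0// exprn_gt0.
exists (12 * C ^+ 2)^-1; first by rewrite invr_gt0.
move=> [//|e] k eps; rewrite ltnS => e0 k0 cov.
have -> : e.+1%:R - 1 = e%:R :> R by rewrite -[e.+1%:R]natr1 addrK.
set D := _ `^ (_ - _).
have D0 : 0 < D by rewrite powR_gt0.
have [eps0 _] := cov.
pose eta := eps / D.
have eta0 : 0 < eta by rewrite divr_gt0.
have epsE : eps = eta * D by rewrite divfK// gt_eqF.
rewrite [leRHS]epsE ler_pM2r//; clearbody eta.
set a := 2 `^ _.
have ae : a ^+ e = 2 ^- k by exact: powR_neg_rootX.
have a0 : 0 <= a by exact: powR_ge0.
have a1 : a <= 1.
  rewrite -(@ler_pXn2r _ e) ?nnegrE// ae expr1n invf_le1 ?exprn_gt0//.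
  by rewrite exprn_ege1// ler1n.
have c1 : (12 * C ^+ 2)^-1 <= 1 by rewrite invf_le1; nra.
have c0 : 0 < (12 * C ^+ 2)^-1 by rewrite invr_gt0.
have [eta1|eta1] := leP 1 eta; first by apply: le_trans eta1; nra.
have := covering_count p0 q0 (ltn0Sn e) (introT andP (conj eta0 eta1)) epsE cov.
rewrite -/C => cnt.
rewrite leNgt; apply/negP => lta.
have : 12 * C ^+ 2 * eta < a.
  by rewrite -ltr_pdivlMl.
have b0 : 0 <= 12 * C ^+ 2 * eta.
  by rewrite mulr_ge0 ?(ltW eta0) ?(ltW C20).
rewrite -(@ltr_pXn2r _ e) ?nnegrE// ae => ltk.
have {}ltk : 2 ^+ k * (12 * C ^+ 2 * eta) ^+ e < 1.
  by rewrite -ltr_pdivlMl ?exprn_gt0// mulr1.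
move: ltk; apply/negP; rewrite -leNgt; apply: le_trans cnt _.
rewrite -[in leRHS](prednK k0) exprS exprS.
have -> : 2 ^+ k.-1 * (3 / eta) * (2 * C * eta * (2 * C * eta) ^+ e)
   = 2 ^+ k.-1 * ((6 * C) * (2 * C * eta) ^+ e) by field; rewrite gt_eqF.
rewrite ler_pM ?exprn_ge0 ?mulr_ge0 ?exprn_ge0 ?mulr_ge0 ?(ltW eta0) ?(ltW C0)//.
  by rewrite ler_peMl ?exprn_ge0//; lra.
have -> : 12 * C ^+ 2 * eta = 6 * C * (2 * C * eta) by ring.
rewrite [leRHS]exprMn ler_wpM2r ?exprn_ge0 ?mulr_ge0 ?(ltW eta0) ?(ltW C0)//.
by rewrite ler_eXnr//; lra.
Qed.

End LowerBound.

(** * The upper bound *)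

Lemma covering_radii_codes (R : realType) (V : lmodType R) k (K B : set V)
    (T : finType) (Z : {set T}) (g : T -> V) (eps : R) :
  0 < eps -> (#|Z| <= 2 ^ k.-1)%N ->
  (forall x, K x -> exists2 z, z \in Z & exists2 b, B b & x = g z + eps *: b) ->
  covering_radii k K B eps.
Proof.
move=> eps0 Zk KZ; split=> //.
exists (fun j => nth 0 [seq g z | z <- enum Z] j) => x /KZ [z zZ [b Bb ->]].
have zi : (index z (enum Z) < 2 ^ k.-1)%N.
  by apply: leq_trans Zk; rewrite cardE index_mem mem_enum.
exists (Ordinal zi) => //=; exists b => //.
by rewrite (nth_map z) ?index_mem ?mem_enum// nth_index ?mem_enum.
Qed.

Lemma truncn_cell_near (R : realType) (h a : R) : 0 < h ->
  `|a - h * ((-1) ^+ (a < 0)%R * (Num.truncn (`|a| / h))%:R)| <= h.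
Proof.
move=> h0; set m := Num.truncn _.
have /andP[m1 m2] : m%:R <= `|a| / h < m%:R + 1.
  by rewrite natr1; apply: truncn_itv; rewrite divr_ge0// ltW.
rewrite ler_pdivlMr// in m1; rewrite ltr_pdivrMr// in m2.
have -> : a - h * ((-1) ^+ (a < 0)%R * m%:R) = (-1) ^+ (a < 0)%R * (`|a| - m%:R * h).
  rewrite mulrBr -realEsign ?num_real//; congr (_ - _).
  by rewrite mulrCA [h * _]mulrC.
by rewrite normrMsign ler_norml; lra.
Qed.

Section UpperBound.
Variables (R : realType) (p q : \bar R).
Hypotheses (p0 : (0 < p)%E) (q0 : (0 < q)%E).
Variable d : nat.
Hypothesis d2 : (2 <= d)%N.

Let D (r : \bar R) : R := d%:R `^ (fine (r^-1)%E).

Let d0 : (0 < d)%N. Proof. exact: ltnW. Qed.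

Let D0 r : 0 < D r. Proof. by rewrite powR_gt0// ltr0n. Qed.

Lemma lpball_of_sup t (x y : 'rV[R]_d) : 0 < t ->
  (forall i, `|x 0 i - y 0 i| <= t / D p) ->
  exists2 b, lpball q d b &
    x = y + (t * d%:R `^ (fine (q^-1)%E - fine (p^-1)%E)) *: b.
Proof.
move=> t0 xy; set eps := t * _.
have epsE : eps = t / D p * D q.
  by rewrite /eps powRB ?pnatr_eq0 -?lt0n ?d0 ?implybT// -mulrA [_^-1 * _]mulrC.
have e0 : 0 < eps by rewrite epsE !mulr_gt0// invr_gt0.
exists (eps^-1 *: (x - y)); last by rewrite scalerA divff ?gt_eqF// scale1r addrC subrK.
rewrite /lpball/= -(@mulfV _ (D q)) ?gt_eqF//.
apply: lpnorm_le_sup => // i; rewrite !mxE normrM gtr0_norm ?invr_gt0//.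
rewrite -(@ler_pM2l _ eps)// mulVKf ?gt_eqF// epsE mulfK ?gt_eqF//.
Qed.

(** If [z] and [z'] are cells of points [x] and [x'] of the sphere and
    [z = z' + j * (1, ..., 1)] with [j >= 1], then [`|x'| < `|x|] in every
    coordinate, which contradicts strict monotonicity of the norm.  Hence the
    translates [z + j * (1, ..., 1)] with [j < J] and [J] about [1/t] are
    pairwise distinct, and [#|Z| * J] of them fit in a neighbourhood of the
    point (1, ..., 1). *)
Lemma sphere_cells_count (t : R) n (Z : {set {ffun 'I_d -> 'I_n}}) :
  0 < t <= 1 ->
  (forall z, z \in Z -> exists2 x, lpsphere p d x &
    forall i, z i = Num.truncn (`|x 0 i| / (t / D p)) :> nat) ->
  #|Z|%:R <= t * (64 * expR (2 / moment_exp p) / t) ^+ d.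
Proof.
move=> /andP[t0 t1] Zx.
have h0 : 0 < t / D p by rewrite divr_gt0.
have ti0 : 0 <= t^-1 by rewrite invr_ge0 ltW.
pose J := (Num.truncn t^-1).+1.
have /andP[J1 J2] : (J%:R - 1 <= t^-1 <= J%:R).
  by have /andP[h1 h2] := truncn_itv ti0; rewrite -natr1 addrK h1/= natr1 ltW.
have shift_lt (zj : {ffun 'I_d -> 'I_n} * 'I_J) i : (zj.1 i + zj.2 < n + J)%N.
  by rewrite -addnS leq_add// ltnW.
pose shift (zj : {ffun 'I_d -> 'I_n} * 'I_J) : {ffun 'I_d -> 'I_(n + J)} :=
  [ffun i => Ordinal (shift_lt zj i)].
have shiftE zj i : shift zj i = (zj.1 i + zj.2)%N :> nat by rewrite ffunE.
have key z z' : z \in Z -> z' \in Z -> exists i, (z i <= z' i)%N.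
  move=> /Zx[x xS zx] /Zx[x' xS' zx']; apply: contrapT => /forallNP nle.
  have : lpnorm p x' < lpnorm p x.
    apply: lt_lpnorm => // i; rewrite -(@ltr_pM2r _ (t / D p)^-1) ?invr_gt0//.
    have : (z' i < z i)%N by rewrite ltnNge; apply/negP.
    rewrite zx zx' truncn_gt_nat => /(lt_le_trans _); apply.
    by have /andP[] := truncn_itv (divr_ge0 (normr_ge0 (x' 0 i)) (ltW h0)).
  by rewrite xS xS' ltxx.
have inj : {in finset.setX Z [set: 'I_J]%SET &, injective shift}.
  have aux zj zj' : zj.1 \in Z -> zj'.1 \in Z -> shift zj = shift zj' -> (zj'.2 <= zj.2)%N.
    move=> zZ zZ' eqs; have [i zi] := key _ _ zZ zZ'.
    have := shiftE zj i; rewrite eqs shiftE => h.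
    by rewrite -(leq_add2l (zj.1 i)) -h leq_add2r.
  move=> [z j] [z' j']; rewrite !inE !andbT => zZ zZ' eqs.
  have jj : j = j'.
    apply/val_inj/eqP; rewrite eqn_leq.
    by rewrite (aux (z', j') (z, j))// (aux (z, j) (z', j')).
  congr (_, _) => //; apply/ffunP => i; apply/val_inj.
  have := shiftE (z, j) i; rewrite eqs shiftE /= jj => /eqP.
  by rewrite eqn_add2r => /eqP.
have : #|shift @: finset.setX Z [set: 'I_J]%SET|%:R <= (64 * expR (2 / moment_exp p) / t) ^+ d.
  apply: (@card_lattice_near R _ _ _ _ (fun=> 1)); [exact: moment_exp_gt0|by rewrite t0|].
  move=> w /imsetP[[z j]]; rewrite !inE andbT /= => zZ ->.
  have [x xS zx] := Zx _ zZ.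
  exists (fun i => D p * `|x 0 i|); split=> [i||i].
  - by rewrite mulr_ge0// ltW.
  - by apply: lpnorm_moment => //; rewrite xS.
  have := truncn_itv (divr_ge0 (normr_ge0 (x 0 i)) (ltW h0)).
  rewrite shiftE /= -zx natrD => /andP[zle _].
  have {}zle : t * (z i)%:R <= D p * `|x 0 i|.
    rewrite ler_pdivlMr// -(ler_pM2l (D0 p)) in zle.
    by apply: le_trans zle; rewrite [t / _]mulrC mulrCA mulVKf ?gt_eqF// mulrC.
  have jle : t * j%:R <= 1.
    rewrite -(@ler_pM2l _ t^-1) ?invr_gt0// mulKf ?gt_eqF// mulr1.
    by apply: le_trans J1; rewrite lerBrDr natr1 ler_nat.
  have tz : 0 <= t * (z i)%:R by rewrite mulr_ge0// ltW.
  have tj : 0 <= t * j%:R by rewrite mulr_ge0// ltW.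
  by rewrite ler_norml; lra.
rewrite card_in_imset// cardsX cardsT card_ord natrM => cnt.
rewrite -ler_pdivrMl//; apply: le_trans cnt.
by rewrite mulrC ler_wpM2l.
Qed.

(** The [2 ^ d] sign patterns are absorbed in the constant, as is one factor
    [C], because [d <= 2 * (d - 1)]. *)
Lemma covering_radii_fine k (t : R) : 0 < t <= 1 ->
  (4 * (64 * expR (2 / moment_exp p)) ^+ 2 / t) ^+ d.-1 <= 2 ^+ k.-1 ->
  covering_radii k (lpsphere p d) (lpball q d)
    (t * d%:R `^ (fine (q^-1)%E - fine (p^-1)%E)).
Proof.
set C := 64 * expR _ => /[dup] t01 /andP[t0 t1] Ck.
have h0 : 0 < t / D p by rewrite divr_gt0.
(* The coordinates of a point of the sphere have modulus at most one. *)
pose n := (Num.truncn (1 / (t / D p))).+1.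
pose Z := finset (fun z : {ffun 'I_d -> 'I_n} => `[< exists2 x, lpsphere p d x &
    forall i, z i = Num.truncn (`|x 0 i| / (t / D p)) :> nat >]).
have cZ : #|Z|%:R <= t * (C / t) ^+ d.
  by apply: sphere_cells_count => // z; rewrite inE => /asboolP.
pose g (c : {ffun 'I_d -> bool} * {ffun 'I_d -> 'I_n}) : 'rV[R]_d :=
  \row_i (t / D p * ((-1) ^+ (c.1 i) * (c.2 i)%:R)).
apply: (@covering_radii_codes _ _ _ _ _ _ (finset.setX [set: {ffun 'I_d -> bool}]%SET Z) g).
- by rewrite mulr_gt0// powR_gt0// ltr0n.
- rewrite cardsX cardsT card_ffun card_bool card_ord.
  rewrite -(@ler_nat R) natrX; apply: le_trans Ck; rewrite natrM natrX.
  have C1 : 1 <= 2 * C.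
    have := expR_ge1Dx (2 / moment_exp p).
    have : 0 < 2 / moment_exp p by rewrite divr_gt0// moment_exp_gt0.
    by rewrite /C; lra.
  have Ct0 : 0 <= 2 * C / t by rewrite divr_ge0 ?(ltW t0)// (le_trans _ C1).
  apply: (@le_trans _ _ (t * (2 * C / t) ^+ d)).
    rewrite -[2 * C / t]mulrA exprMn mulrCA ler_wpM2l ?exprn_ge0//.
  have -> : 4 * C ^+ 2 / t = 2 * C * (2 * C / t) by ring.
  rewrite -[X in _ ^+ X](prednK d0) exprS mulrA.
  have -> : t * (2 * C / t) = 2 * C by rewrite mulrC divfK// gt_eqF.
  rewrite [leRHS]exprMn; apply: ler_wpM2r; first exact: exprn_ge0.
  by rewrite ler_eXnr// -ltnS prednK.
move=> x xS.
have zlt i : (Num.truncn (`|x 0%R i| / (t / D p)) < n)%N.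
  rewrite ltnS; apply: le_truncn; rewrite ler_wpM2r ?invr_ge0 ?(ltW h0)//.
  by rewrite -xS; apply: lpnorm_coord.
pose z := [ffun i => Ordinal (zlt i)].
exists ([ffun i => x 0 i < 0], z).
  by rewrite !inE; exists x => // i; rewrite ffunE.
apply: lpball_of_sup => // i; rewrite mxE /= !ffunE /=.
exact: truncn_cell_near.
Qed.

(** Only nonzero rounded coordinates carry a sign, since a free sign for each
    coordinate would already take [2 ^ d] centres. *)
Lemma covering_radii_coarse k : (d <= k)%N ->
  covering_radii k (lpsphere p d) (lpball q d)
    ((8 * (19 + 2 / moment_exp p)) `^ (moment_exp p)^-1
      * d%:R `^ (fine (q^-1)%E - fine (p^-1)%E)).
Proof.
move=> dk; have s0 := moment_exp_gt0 p0; set s := moment_exp p in s0 *.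
set K := 8 * _; have K0 : 0 < K by rewrite mulr_gt0// addr_gt0// divr_gt0.
set t := K `^ _.
have t0 : 0 < t by rewrite powR_gt0.
have ts : t `^ s = K by rewrite /t -powRrM mulVf ?gt_eqF// powRr1// ltW.
have h0 : 0 < t / D p by rewrite divr_gt0.
(* The coordinates of a point of the sphere have modulus at most one. *)
pose n := (Num.truncn (1 / (t / D p))).+1.
pose m (x : 'rV[R]_d) i := Num.truncn (`|x 0 i| / (t / D p)).
pose Z := finset (fun z : {ffun 'I_d -> bool * 'I_n} =>
  `[< exists2 x, lpsphere p d x & forall i,
      (z i).1 = (x 0 i < 0) && (m x i != 0%N) /\ (z i).2 = m x i :> nat >]).
pose g (c : {ffun 'I_d -> bool * 'I_n}) : 'rV[R]_d :=
  \row_i (t / D p * ((-1) ^+ (c i).1 * (c i).2%:R)).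
apply: (@covering_radii_codes _ _ _ _ _ _ Z g).
- by rewrite mulr_gt0// powR_gt0// ltr0n.
- apply: (@leq_trans (2 ^ d.-1)); last first.
    by rewrite leq_exp2l// -!subn1 leq_sub2r.
  apply: (card_sparse_lattice s0) => // z; rewrite inE => /asboolP[x xS zx].
  split=> [i zi0|]; first by have [-> <-] := zx i; rewrite zi0 andbF.
  have xS' : lpnorm p x <= 1 by rewrite xS.
  apply: le_trans (lpnorm_moment p0 xS'); apply: ler_sum => i _.
  rewrite -/K -ts -powRM ?ler0n ?(ltW t0)//.
  apply: ge0_ler_powR; rewrite ?nnegrE ?mulr_ge0 ?(ltW s0) ?(ltW t0) ?(ltW (D0 p))//.
  have [_ ->] := zx i.
  have /andP[mle _] := truncn_itv (divr_ge0 (normr_ge0 (x 0 i)) (ltW h0)).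
  rewrite -/(m x i) ler_pdivlMr// -(ler_pM2l (D0 p)) in mle.
  by apply: le_trans mle; rewrite [t / _]mulrC mulrCA mulVKf ?gt_eqF// mulrC.
move=> x xS.
have zlt i : (m x i < n)%N.
  rewrite ltnS; apply: le_truncn; rewrite ler_wpM2r ?invr_ge0 ?(ltW h0)//.
  by rewrite -xS; apply: lpnorm_coord.
exists [ffun i => ((x 0 i < 0) && (m x i != 0%N), Ordinal (zlt i))].
  by rewrite inE; apply/asboolP; exists x => // i; rewrite ffunE.
apply: lpball_of_sup => // i; rewrite mxE !ffunE /=.
apply: le_trans (truncn_cell_near (x 0 i) h0); rewrite -/(m x i).
by case: eqP => [->|_]; rewrite ?mulr0 ?andbT.
Qed.

End UpperBound.

(** The scale [t = 2 * F * 2 `^ (- k / (d - 1))] is the one at which the fine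
    covering needs at most [2 ^ (k - 1)] centres.  When it exceeds one, the
    coarse covering has comparable radius. *)
Lemma covering_radii_le (R : realType) (p q : \bar R) :
  (0 < p)%E -> (0 < q)%E ->
  exists2 C : R, 0 < C & forall d k, (2 <= d)%N -> (d <= k)%N ->
    exists2 eps, covering_radii k (lpsphere p d) (lpball q d) eps &
      eps <= C * 2 `^ (- (k%:R / (d%:R - 1)))
        * d%:R `^ (fine (q^-1)%E - fine (p^-1)%E).
Proof.
move=> p0 q0; set F := 4 * (64 * expR (2 / moment_exp p)) ^+ 2.
have F0 : 0 < F by rewrite mulr_gt0// exprn_gt0// mulr_gt0// expR_gt0.
set A := (8 * (19 + 2 / moment_exp p)) `^ (moment_exp p)^-1.
have A0 : 0 <= A by exact: powR_ge0.
have A1 : 0 < 1 + A by exact: ltr_pwDl.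
exists (2 * F * (1 + A)); first by rewrite mulr_gt0// mulr_gt0.
move=> [//|e] k e0 ek.
have -> : e.+1%:R - 1 = e%:R :> R by rewrite -[e.+1%:R]natr1 addrK.
have k0 : (0 < k)%N by apply: leq_trans ek.
set a := 2 `^ _.
have ae : a ^+ e = 2 ^- k by exact: powR_neg_rootX.
have a0 : 0 < a by exact: powR_gt0.
set S := _ `^ (_ - _).
have S0 : 0 < S by rewrite powR_gt0.
have [t1|t1] := leP (2 * F * a) 1; last first.
  exists (A * S); first exact: covering_radii_coarse.
  rewrite ler_pM2r//; have : 0 <= F * a by rewrite mulr_ge0// ltW.
  by move: (F * a) (A) A0 t1 => v w; nra.
exists (2 * F * a * S).
  apply: covering_radii_fine => //; first by rewrite t1 mulr_gt0// mulr_gt0.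
  rewrite -/F (_ : F / (2 * F * a) = (2 * a)^-1); last by field; rewrite !gt_eqF.
  rewrite /= exprVn exprMn ae invfM invrK mulrC ler_pdivrMr ?exprn_gt0//.
  rewrite -[in leLHS](prednK k0) exprSr ler_wpM2l ?exprn_ge0//.
  by rewrite ler_eXnr// ler1n.
rewrite ler_pM2r// ler_pM2r// ler_peMr ?lerDl//.
by rewrite mulr_ge0// ltW.
Qed.

(** * Attainment of the minimum *)

Section Minimum.
Variables (R : realType) (q : \bar R).
Hypothesis q0 : (0 < q)%E.
Local Open Scope classical_set_scope.

Lemma translate_lpballP d (eps : R) (x y : 'rV[R]_d) : 0 < eps ->
  [set y + eps *: b | b in lpball q d] x <-> lpnorm q (x - y) <= eps.
Proof.
move=> e0; split=> [[b b1 <-]|xy].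
  by rewrite addrC addKr lpnormZ ?(ltW e0)// -[leRHS]mulr1 ler_pM2l.
exists (eps^-1 *: (x - y)); last by rewrite scalerA divff ?gt_eqF// scale1r addrC subrK.
by rewrite /lpball/= lpnormZ ?invr_ge0 ?(ltW e0)// ler_pdivrMl// mulr1.
Qed.

Lemma covering_radiiP d k (K : set 'rV[R]_d) (eps : R) : 0 < eps ->
  covering_radii k K (lpball q d) eps <->
  exists x : 'I_(2 ^ k.-1) -> 'rV[R]_d,
    forall y, K y -> exists j, lpnorm q (y - x j) <= eps.
Proof.
move=> e0; split=> [[_ [x xK]]|[x xK]].
  by exists x => y /xK[j _ /(translate_lpballP _ _ e0) yx]; exists j.
split=> //; exists x => y /xK[j yx]; exists j => //.
by apply/(translate_lpballP _ _ e0).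
Qed.

Lemma continuous_row_entry (T : topologicalType) n (j : 'I_n) :
  continuous (fun w : 'rV[T]_n => w 0 j).
Proof.
move=> w A wA; exists (fun _ j' => if j' == j then A else setT) => /=.
  by move=> i j'; rewrite ord1; case: eqP => [->//|_]; exact: filterT.
by move=> w' /(_ 0 j); rewrite eqxx.
Qed.

(** Take a cluster point [w], as [eps] decreases to the infimum, of
    configurations of centres for the radius [eps].  Balls that miss [K] are
    recentred at 0, so that all configurations stay in a compact box.  Every
    point of [K] is within each [eps > inf E] of some centre of [w], hence
    within [inf E] of the nearest one. *)
Lemma covering_radii_minimum d k (K : set 'rV[R]_d) (r L : R) :
  0 <= r -> (forall x i, K x -> `|x 0 i| <= r) ->
  0 < L -> lbound (covering_radii k K (lpball q d)) L ->
  covering_radii k K (lpball q d) !=set0 ->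
  exists2 eps, covering_radii k K (lpball q d) eps &
    lbound (covering_radii k K (lpball q d)) eps.
Proof.
set E := covering_radii _ _ _ => r0 Kr L0 EL E0.
pose e0 := inf E.
have e00 : 0 < e0 by apply: lt_le_trans L0 _; exact: lb_le_inf.
exists e0; last by apply: ge_inf; exists L.
pose M := r + (e0 + 1).
have bounded e : e0 < e -> exists x : 'I_(2 ^ k.-1) -> 'rV[R]_d,
    (forall y, K y -> exists j, lpnorm q (y - x j) <= e) /\
    forall j i, `|x j 0 i| <= r + e.
  move=> ee; have [e' Ee' lte'] := inf_lt E0 ee.
  have e'0 : 0 < e' by case: Ee'.
  have [x xK] := (covering_radiiP k K e'0).1 Ee'.
  exists (fun j => if `[< exists2 y, K y & lpnorm q (y - x j) <= e >] then x j else 0).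
  split=> [y Ky|j i].
    have [j yj] := xK _ Ky; exists j.
    have {}yj : lpnorm q (y - x j) <= e by apply: le_trans yj (ltW _).
    by rewrite asboolT//; exists y.
  case: asboolP => [[y Ky yj]|_]; last first.
    by rewrite mxE normr0 addr_ge0// (le_trans (ltW e00) (ltW ee)).
  have -> : x j 0 i = y 0 i - (y - x j) 0 i by rewrite !mxE subKr.
  apply: le_trans (ler_normB _ _) _.
  by rewrite lerD ?Kr//; apply: le_trans yj; exact: lpnorm_coord.
have /choice[X XP] : forall e, exists x : 'I_(2 ^ k.-1) -> 'rV[R]_d, e0 < e ->
    (forall y, K y -> exists j, lpnorm q (y - x j) <= e) /\
    forall j i, `|x j 0 i| <= r + e.
  move=> e; have [/bounded[x xP]|_] := ltP e0 e; first by exists x.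
  by exists (fun=> 0).
pose W (e : R) : 'rV['rV[R]_d]_(2 ^ k.-1) := \row_j X e j.
pose box := [set v : 'rV[R]_d | forall i, `[- M, M]%classic (v ord0 i)].
have cbox : compact box.
  by apply: (@rV_compact _ _ (fun=> `[- M, M]%classic)) => _; exact: segment_compact.
have cboxes : compact [set w : 'rV['rV[R]_d]_(2 ^ k.-1) | forall j, box (w ord0 j)].
  exact: (@rV_compact _ _ (fun=> box)).
have nearbox : \forall e \near e0^'+, forall j, box (W e ord0 j).
  near=> e => j i /=; rewrite /W mxE in_itv/= -ler_norml.
  have ee : e0 < e by near: e; exact: nbhs_right_gt.
  apply: le_trans ((XP e ee).2 j i) _; rewrite lerD2l.
  by near: e; apply: nbhs_right_le; rewrite ltrDl.
have [w [_ wcl]] := cboxes (W e @[e --> e0^'+]) _ nearbox.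
have wK y e : K y -> e0 < e -> exists j, lpnorm q (y - w 0 j) <= e.
  move=> Ky ee; pose D := \bigcup_j
    [set w' : 'rV['rV[R]_d]_(2 ^ k.-1) | lpnorm q (y - w' 0 j) <= e].
  suff : D w by case=> j _; exists j.
  have cD : closed D.
    apply: closed_bigcup => [|j _]; first exact: finite_finset.
    apply: (@closed_comp _ _ (fun w' : 'rV['rV[R]_d]_(2 ^ k.-1) => w' 0 j)
      [set v | lpnorm q (y - v) <= e]).
      by move=> w' _; exact: continuous_row_entry.
    by apply: closed_lpnorm_le => //; exact: ltW (lt_trans e00 ee).
  rewrite ((closure_id D).1 cD); move: wcl; rewrite clusterE; apply.
  suff : \forall e' \near e0^'+, D (W e') by [].
  near=> e'; have ee' : e0 < e' by near: e'; exact: nbhs_right_gt.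
  have [j yj] := (XP e' ee').1 y Ky; exists j => //=.
  rewrite /W mxE; apply: le_trans yj _.
  by near: e'; exact: nbhs_right_le.
apply/covering_radiiP => //; exists (fun j => w 0 j) => y Ky.
have j0 : 'I_(2 ^ k.-1) by exists 0%N; rewrite expn_gt0.
have [j _ jmin] := @arg_minP _ _ _ j0 xpredT (fun j => lpnorm q (y - w 0 j)) isT.
exists j; apply/ler_addgt0Pr => e egt0.
have [j' yj'] := wK y (e0 + e) Ky (ltac:(by rewrite ltrDl)).
exact: le_trans (jmin j' isT) yj'.
Unshelve. all: by end_near. Qed.

End Minimum.

Lemma entropy_number_min (R : realType) (V : lmodType R) k (K B : set V) eps :
  covering_radii k K B eps -> lbound (covering_radii k K B) eps ->
  entropy_number k K B = eps.
Proof.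
move=> Ee le; apply: xget_unique => // e' [Ee' le'].
by apply/eqP; rewrite eq_le le' ?le.
Qed.

(** * Entropy numbers of spheres *)

(* In \bar R, +oo^-1 = 0, so [fine (p^-1)%E] is 1/p with 1/oo = 0. *)
Theorem theorem3 (R : realType) (p q : \bar R)
    (hp : (0 < p)%E) (hpq : (p <= q)%E) :
  exists c C : R, [/\ 0 < c, 0 < C &
    forall d k : nat, (2 <= d)%N -> (d <= k)%N ->
      c * 2 `^ (- (k%:R / (d%:R - 1)))
        * d%:R `^ (fine (q^-1)%E - fine (p^-1)%E)
      <= entropy_number k (lpsphere p d) (lpball q d)
      <= C * 2 `^ (- (k%:R / (d%:R - 1)))
        * d%:R `^ (fine (q^-1)%E - fine (p^-1)%E)].
Proof.
have hq : (0 < q)%E by apply: lt_le_trans hpq.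
have [c c0 lower] := covering_radii_ge hp hq.
have [C C0 upper] := covering_radii_le hp hq.
exists c, C; split=> // d k d2 dk.
have k0 : (0 < k)%N by apply: leq_trans dk; exact: ltnW.
have [e Ee eC] := upper d k d2 dk.
have cL : lbound (covering_radii k (lpsphere p d) (lpball q d))
    (c * 2 `^ (- (k%:R / (d%:R - 1))) * d%:R `^ (fine (q^-1)%E - fine (p^-1)%E)).
  by move=> e' Ee'; exact: lower.
have S1 (x : 'rV[R]_d) i : lpsphere p d x -> `|x 0 i| <= 1.
  by move=> xS; rewrite -xS; exact: lpnorm_coord.
have [||m Em Lm] := covering_radii_minimum hq ler01 S1 _ cL.
- by rewrite mulr_gt0 ?mulr_gt0 ?powR_gt0// ltr0n ltnW.
- by exists e.
rewrite (entropy_number_min Em Lm) cL//=.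
by apply: le_trans eC; exact: Lm.
Qed.
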